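(* Let $Q$ be a commutative semicartesian quantale. Every Scott-complete $Q$-set is gluing-complete.
   Context: A quantale is a complete lattice $(Q,\le)$ with an associative binary operation $\otimes$ that distributes over arbitrary suprema in each variable. It is commutative if $\otimes$ is commutative and semicartesian if $a\otimes b\le a\wedge b$ for all $a,b$. A $Q$-set is a set $X$ with a map $\delta:X\times X\to Q$ such that for all $x,y,z$: $\delta(x,y)=\delta(y,x)$; $\delta(x,y)\otimes\delta(y,z)\le\delta(x,z)$; $\delta(x,x)\otimes\delta(x,y)=\delta(x,y)$. The extent of $x$ is $Ex:=\delta(x,x)$. A compatible family of $X$ is a (possibly empty) subset $A\subseteq X$ with $\delta(a,b)=Ea\otimes Eb$ for all $a,b\in A$. An element $x_A\in X$ is a gluing of $A$ (glues $A$) if $\delta(a,x_A)=Ea$ for all $a\in A$ and $Ex_A=\bigvee_{a\in A}Ea$. $X$ is gluing-complete if every compatible family has exactly one gluing. A singleton on $X$ is a map $\sigma:X\to Q$ such that for all $x,y\in X$: $\sigma(x)\otimes Ex=\sigma(x)$; $\sigma(x)\otimes\delta(x,y)\le\sigma(y)$; $\sigma(x)\otimes\sigma(y)\le\delta(x,y)$; $\sigma(x)\otimes\bigvee_{y\in X}\sigma(y)=\sigma(x)$. An element $x_\sigma\in X$ represents $\sigma$ if $\sigma(y)=\delta(y,x_\sigma)$ for all $y\in X$. $X$ is Scott-complete if every singleton on $X$ has exactly one representing element. *)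

(* Defs.v *)
From HB Require Import structures.
From mathcomp Require Import all_boot all_order.
From mathcomp Require Import classical_sets.

Set Implicit Arguments.
Unset Strict Implicit.
Unset Printing Implicit Defensive.

Import Order.TTheory.
Local Open Scope classical_set_scope.
Local Open Scope order_scope.

Reserved Notation "x ⊗ y" (at level 40, left associativity).

(* [supremums A] and [infimums A] are the sets of least upper bounds and of
   greatest lower bounds of [A]; [A] ranges over all subsets, including the
   empty one, so a complete lattice has a bottom and a top.
   The choice structure underlying [Order.Lattice] is no restriction: classically
   every type has one. *)
HB.mixin Record Lattice_isComplete (d : Order.disp_t) T of Order.Lattice d T :=
  { qsup : set T -> T;
    qinf : set T -> T;
    qsupP : forall A : set T, supremums A (qsup A);
    qinfP : forall A : set T, infimums A (qinf A) }.

#[short(type="completeLatticeType")]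
HB.structure Definition CompleteLattice (d : Order.disp_t) :=
  { T of Order.Lattice d T & Lattice_isComplete d T }.

HB.mixin Record CompleteLattice_isQuantale (d : Order.disp_t) T
    of CompleteLattice d T :=
  { qmul : T -> T -> T;
    qmulA : associative qmul;
    qmul_supr : forall (a : T) (B : set T),
      qmul a (qsup B) = qsup [set qmul a b | b in B];
    qmul_supl : forall (B : set T) (a : T),
      qmul (qsup B) a = qsup [set qmul b a | b in B] }.

#[short(type="quantaleType")]
HB.structure Definition Quantale (d : Order.disp_t) :=
  { T of CompleteLattice d T & CompleteLattice_isQuantale d T }.

Notation "x ⊗ y" := (qmul x y) : order_scope.

Definition commutative_quantale (d : Order.disp_t) (Q : quantaleType d) : Prop :=
  commutative (@qmul d Q).

Definition semicartesian (d : Order.disp_t) (Q : quantaleType d) : Prop :=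
  forall a b : Q, a ⊗ b <= a `&` b.

Record qset (d : Order.disp_t) (Q : quantaleType d) := QSet {
  qset_carrier :> Type;
  delta : qset_carrier -> qset_carrier -> Q;
  delta_sym : forall x y, delta x y = delta y x;
  delta_trans : forall x y z, delta x y ⊗ delta y z <= delta x z;
  delta_ext : forall x y, delta x x ⊗ delta x y = delta x y }.

Section QSetNotions.
Variables (d : Order.disp_t) (Q : quantaleType d) (X : qset Q).

Definition extent (x : X) : Q := delta x x.

Definition compatible_family (A : set X) : Prop :=
  forall a b : X, A a -> A b -> delta a b = extent a ⊗ extent b.

Definition glues (A : set X) (x : X) : Prop :=
  (forall a : X, A a -> delta a x = extent a) /\
  extent x = qsup [set extent a | a in A].

Definition gluing_complete : Prop :=
  forall A : set X, compatible_family A -> exists! x : X, glues A x.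

Record is_singleton (sigma : X -> Q) : Prop := IsSingleton {
  singleton_ext : forall x, sigma x ⊗ extent x = sigma x;
  singleton_trans : forall x y, sigma x ⊗ delta x y <= sigma y;
  singleton_le_delta : forall x y, sigma x ⊗ sigma y <= delta x y;
  singleton_sup : forall x, sigma x ⊗ qsup (range sigma) = sigma x }.

Definition represents (sigma : X -> Q) (x : X) : Prop :=
  forall y : X, sigma y = delta y x.

Definition scott_complete : Prop :=
  forall sigma : X -> Q, is_singleton sigma -> exists! x : X, represents sigma x.

End QSetNotions.

(* Main.v *)
Require Import Defs.
From mathcomp Require Import all_boot all_order.
From mathcomp Require Import classical_sets.

(** The proof attaches to a subset [A] of [X] the map
    [sigma x = sup_(a in A) delta a x], the degree to which [x] coincides with
    some member of [A].  When [A] is compatible this map is a singleton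
    ([family_map_singleton]); the compatibility equation
    [delta a b = extent a ⊗ extent b] is what makes two approximations
    [delta x a] and [delta b y] compose through [delta a b].  An
    element glues [A] exactly when it represents [sigma] ([glues_represents]).
    Unique representability of [sigma] is therefore literally unique gluing of
    [A]. *)

Set Implicit Arguments.
Unset Strict Implicit.
Unset Printing Implicit Defensive.

Import Order.TTheory.
Local Open Scope classical_set_scope.
Local Open Scope order_scope.

Lemma le_qsup d (Q : quantaleType d) (I : Type) (A : set I) (f : I -> Q) (i : I) :
  A i -> f i <= qsup [set f j | j in A].
Proof. by move=> Ai; apply: (qsupP _).1; exists i. Qed.

Lemma qsup_le d (Q : quantaleType d) (I : Type) (A : set I) (f : I -> Q) (u : Q) :
  (forall i, A i -> f i <= u) -> qsup [set f j | j in A] <= u.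
Proof. by move=> fu; apply: (qsupP _).2 => _ [i Ai <-]; exact: fu. Qed.

Lemma qmul_qsupr_le d (Q : quantaleType d) (I : Type) (A : set I)
    (f : I -> Q) (c u : Q) :
  (forall i, A i -> c ⊗ f i <= u) -> c ⊗ qsup [set f j | j in A] <= u.
Proof.
move=> fu; rewrite qmul_supr; apply: qsup_le => _ [i Ai <-]; exact: fu.
Qed.

Lemma qmul_qsupl_le d (Q : quantaleType d) (I : Type) (A : set I)
    (f : I -> Q) (c u : Q) :
  (forall i, A i -> f i ⊗ c <= u) -> qsup [set f j | j in A] ⊗ c <= u.
Proof.
move=> fu; rewrite qmul_supl; apply: qsup_le => _ [i Ai <-]; exact: fu.
Qed.

(** If [a <= b] then [b] is the supremum of [{a, b}], so distributivity over
    this supremum gives monotonicity. *)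
Lemma qmul_le2l d (Q : quantaleType d) (c a b : Q) : a <= b -> c ⊗ a <= c ⊗ b.
Proof.
move=> ab; have -> : b = qsup [set x | x in [set a; b]].
  apply: le_anti; rewrite (le_qsup id); last by right.
  by apply: qsup_le => _ [->|->].
by rewrite qmul_supr; apply: le_qsup; exists a => //; left.
Qed.

Lemma qmul_le2r d (Q : quantaleType d) (Qcomm : commutative_quantale Q)
    (c a b : Q) : a <= b -> a ⊗ c <= b ⊗ c.
Proof. by rewrite !(Qcomm _ c); exact: qmul_le2l. Qed.

Lemma qmul_lel d (Q : quantaleType d) (Qsemi : semicartesian Q) (a b : Q) :
  a ⊗ b <= a.
Proof. by apply: le_trans (Qsemi a b) _; exact: leIl. Qed.

Lemma delta_extr d (Q : quantaleType d) (Qcomm : commutative_quantale Q)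
    (X : qset Q) (x y : X) : delta x y ⊗ extent y = delta x y.
Proof. by rewrite Qcomm (delta_sym x y) delta_ext. Qed.

Lemma delta_le_extent d (Q : quantaleType d) (Qsemi : semicartesian Q)
    (X : qset Q) (x y : X) : delta x y <= extent x.
Proof. by rewrite -delta_ext; exact: qmul_lel. Qed.

Definition family_map d (Q : quantaleType d) (X : qset Q) (A : set X) (x : X) : Q :=
  qsup [set delta a x | a in A].

(** Compatibility gives the third axiom, through
    [delta x a ⊗ delta b y = delta x a ⊗ (extent a ⊗ extent b) ⊗ delta b y
     = delta x a ⊗ delta a b ⊗ delta b y <= delta x y].
    For the last axiom, the total supremum of the map dominates
    [delta a a = extent a], which is a unit for [delta a x]. *)
Lemma family_map_singleton d (Q : quantaleType d)
    (Qcomm : commutative_quantale Q) (Qsemi : semicartesian Q)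
    (X : qset Q) (A : set X) :
  compatible_family A -> is_singleton (family_map A).
Proof.
move=> Acomp; split=> [x|x y|x y|x].
- apply: le_anti; rewrite (qmul_lel Qsemi) /=.
  apply: qsup_le => a Aa; rewrite -(delta_extr Qcomm).
  by apply: (qmul_le2r Qcomm); exact: (le_qsup (fun a => delta a x)).
- apply: qmul_qsupl_le => a Aa; apply: le_trans (delta_trans _ _ _) _.
  exact: (le_qsup (fun a => delta a y)).
- apply: qmul_qsupl_le => a Aa; apply: qmul_qsupr_le => b Ab.
  have -> : delta a x ⊗ delta b y = delta x a ⊗ delta a b ⊗ delta b y.
    rewrite (Acomp _ _ Aa Ab) qmulA (delta_extr Qcomm) -qmulA.
    by rewrite delta_ext (delta_sym x).
  apply: le_trans (delta_trans x b y).
  by apply: (qmul_le2r Qcomm); exact: delta_trans.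
- apply: le_anti; rewrite (qmul_lel Qsemi) /=.
  apply: qsup_le => a Aa; rewrite -delta_ext Qcomm.
  have dx : delta a x <= family_map A x.
    exact: (le_qsup (fun a => delta a x)).
  apply: le_trans (qmul_le2r Qcomm _ dx) _; apply: qmul_le2l.
  apply: le_trans (le_qsup (fun b => delta b a) Aa) _.
  exact: (le_qsup (A := setT) (family_map A)).
Qed.

(** If [x] glues [A], then [delta y x = delta y x ⊗ extent x] is the supremum of
    the [delta y x ⊗ extent a = delta y x ⊗ delta x a <= delta y a], while
    [delta y a = delta y a ⊗ delta a x <= delta y x]; hence [x] represents the
    map.  Conversely, the map takes the value [extent a] at each [a] in [A],
    since every [delta b a] is at most [delta a a]; evaluating the map at [x]
    itself then gives the extent of [x]. *)
Lemma glues_represents d (Q : quantaleType d)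
    (Qcomm : commutative_quantale Q) (Qsemi : semicartesian Q)
    (X : qset Q) (A : set X) (x : X) :
  glues A x <-> represents (family_map A) x.
Proof.
split=> [[dx Ex] y|repx].
- apply: le_anti; apply/andP; split.
    apply: qsup_le => a Aa; rewrite delta_sym -(delta_extr Qcomm) -(dx _ Aa).
    exact: delta_trans.
  rewrite -(delta_extr Qcomm) Ex; apply: qmul_qsupr_le => a Aa.
  rewrite -(dx _ Aa) (delta_sym a); apply: le_trans (delta_trans _ _ _) _.
  by rewrite delta_sym; exact: (le_qsup (fun a => delta a y)).
- have dx a : A a -> delta a x = extent a.
    move=> Aa; apply: le_anti; rewrite (delta_le_extent Qsemi) /= -repx.
    exact: (le_qsup (fun b => delta b a)).
  split=> //; rewrite /extent -repx; congr qsup.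
  by apply: eq_imagel => a Aa; exact: dx.
Qed.

Theorem mainTheorem1 (d : Order.disp_t) (Q : quantaleType d)
    (Qcomm : commutative_quantale Q) (Qsemi : semicartesian Q) (X : qset Q) :
  scott_complete X -> gluing_complete X.
Proof.
move=> scott A Acomp.
have [x [repx uniqx]] := scott _ (family_map_singleton Qcomm Qsemi Acomp).
exists x; split=> [|y yA]; first exact/(glues_represents Qcomm Qsemi).
by apply: uniqx; exact/(glues_represents Qcomm Qsemi).
Qed.
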